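(* Let $P=P^X$ be a probability measure over $\mathbb{R}^k$ and fix $\theta\in\mathbb{R}^k$. Let $t_{\theta,P}=\sup_{u\in\mathcal{S}^{k-1}}\mathrm{pr}\{u^T(X-\theta)=0\}$. Then the depth region $R_\theta(\alpha,P)=\{V\in\mathcal{P}_{k,\mathrm{tr}}: D_\theta(V,P)\geq\alpha\}$ is bounded and compact for any $\alpha>t_{\theta,P}$.
   Context: $P=P^X$ denotes the distribution of a random $k$-vector $X$, and $\mathrm{pr}$ denotes probability under $P$. $\mathcal{P}_k$ is the set of $k\times k$ real symmetric positive definite matrices, $A^{1/2}$ is the unique square root of $A\in\mathcal{P}_k$ in $\mathcal{P}_k$, $A^{-1/2}$ is the inverse of $A^{1/2}$, and $\mathcal{P}_{k,\mathrm{tr}}=\{V\in\mathcal{P}_k:\mathrm{tr}(V)=k\}$ is the set of shape matrices. $\mathcal{S}^{m-1}$ is the unit sphere of $\mathbb{R}^m$. For $V\in\mathcal{P}_{k,\mathrm{tr}}$, let $U_{\theta,V}=V^{-1/2}(X-\theta)/\|V^{-1/2}(X-\theta)\|$ if $X\neq\theta$ and $U_{\theta,V}=0$ otherwise, and let $W_{\theta,V}=\mathrm{vec}\{U_{\theta,V}U_{\theta,V}^T-(1/k)I_k\}\in\mathbb{R}^{k^2}$, where $\mathrm{vec}$ stacks the columns of a matrix. The fixed-$\theta$ (Tyler) shape depth of $V$ with respect to $P$ is $$D_\theta(V,P)=\inf_{u\in\mathcal{S}^{k^2-1}}\mathrm{pr}(u^T W_{\theta,V}\geq 0).$$ Topological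 statements about $\mathcal{P}_{k,\mathrm{tr}}$ refer to the topology induced by the geodesic distance $d(V_a,V_b)=\|\log(V_a^{-1/2}V_bV_a^{-1/2})\|_F$, where $\log$ is the matrix logarithm and $\|A\|_F=\{\mathrm{tr}(AA^T)\}^{1/2}$. A subset $R$ of $\mathcal{P}_{k,\mathrm{tr}}$ is bounded if and only if $R\subset\{V\in\mathcal{P}_{k,\mathrm{tr}}:d(V,I_k)<r\}$ for some $r>0$. *)

(* Defs.v *)
From HB Require Import structures.
From mathcomp Require Import all_boot all_order all_algebra.
From mathcomp Require Import all_classical all_reals all_analysis.

Set Implicit Arguments.
Unset Strict Implicit.
Unset Printing Implicit Defensive.

Import Order.TTheory GRing.Theory Num.Theory.
Import numFieldNormedType.Exports.

Local Open Scope classical_set_scope.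
Local Open Scope ring_scope.

Section euclid.
Context {R : realType}.

(* The library norm on matrices is the sup norm; the Euclidean and Frobenius
   norms are introduced separately. *)
Definition enorm {m : nat} (x : 'cV[R]_m) : R :=
  Num.sqrt (\sum_i x i 0 ^+ 2).

Definition sphere (m : nat) : set 'cV[R]_m := [set u | enorm u = 1].

Definition dotv {m : nat} (u v : 'cV[R]_m) : R := (u^T *m v) 0 0.

Definition frobenius {k : nat} (A : 'M[R]_k) : R := Num.sqrt (\tr (A *m A^T)).

(* [mxvec] lists the entries row by row, hence the transposition. *)
Definition vec {k : nat} (A : 'M[R]_k) : 'cV[R]_(k * k) := (mxvec A^T)^T.

End euclid.
Arguments sphere R m : clear implicits.

Section posdef.
Context {R : realType} {k : nat}.

Definition posdef : set 'M[R]_k :=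
  [set A | A^T = A /\ forall x : 'cV[R]_k, x != 0 -> 0 < (x^T *m A *m x) 0 0].

(* The default value [0] only matters outside [posdef]. *)
Definition sqrtmx (A : 'M[R]_k) : 'M[R]_k :=
  xget 0 [set B | posdef B /\ B *m B = A].

Definition isqrtmx (A : 'M[R]_k) : 'M[R]_k := invmx (sqrtmx A).

(* Spectral calculus: log (Q diag(l) Q^T) = Q diag(ln l) Q^T for Q orthogonal;
   the result does not depend on the diagonalization chosen.  The default value
   [0] only matters outside [posdef]. *)
Definition logmx (A : 'M[R]_k) : 'M[R]_k :=
  xget 0 [set L | exists Q : 'M[R]_k, exists l : 'rV[R]_k,
    [/\ Q *m Q^T = 1%:M, forall i, 0 < l 0 i,
        A = Q *m diag_mx l *m Q^T &
        L = Q *m diag_mx (map_mx (@ln R) l) *m Q^T]].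

Definition geodist (A B : 'M[R]_k) : R :=
  frobenius (logmx (isqrtmx A *m B *m isqrtmx A)).

End posdef.

Section shape.
Context (R : realType) (k : nat).

Definition is_shape (V : 'M[R]_k) : bool :=
  `[< posdef V /\ \tr V = k%:R >].

Record shape_matrix := Shape { shape_mx :> 'M[R]_k ; _ : is_shape shape_mx }.

HB.instance Definition _ := [isSub for shape_mx].
HB.instance Definition _ := [Choice of shape_matrix by <:].

Definition geoball (V : shape_matrix) (r : R) : set shape_matrix :=
  [set W | geodist V W < r].

Definition geo_open : set_system shape_matrix :=
  [set O | forall V, O V -> exists2 r, 0 < r & geoball V r `<=` O].

Lemma geo_openT : geo_open setT.
Proof. by move=> V _; exists 1. Qed.

Lemma geo_openI : setI_closed geo_open.
Proof.
move=> A B oA oB V [/oA[r r0 rA] /oB[s s0 sB]].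
exists (Num.min r s); first by rewrite lt_min r0.
by move=> W; rewrite /geoball /= lt_min => /andP[Wr Ws]; split;
  [exact: rA | exact: sB].
Qed.

Lemma geo_open_bigU (I : Type) (f : I -> set shape_matrix) :
  (forall i, geo_open (f i)) -> geo_open (\bigcup_i f i).
Proof.
move=> of_ V [i _ /of_[r r0 rf]]; exists r => // W /rf fW.
by exists i.
Qed.

HB.instance Definition _ :=
  isOpenTopological.Build shape_matrix geo_openT geo_openI geo_open_bigU.

Definition geo_bounded (A : set shape_matrix) : Prop :=
  exists2 r : R, 0 < r & A `<=` [set V | geodist V 1%:M < r].

End shape.

(* R^k with its Borel sigma-algebra. *)
Definition borel_cV (R : realType) (k : nat) :=
  g_sigma_algebraType (@open 'cV[R]_k).

HB.instance Definition _ (R : realType) (k : nat) :=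
  Measurable.on (borel_cV R k).

Section depth.
Context {R : realType} {k : nat}.
Implicit Types (theta x : 'cV[R]_k) (V : 'M[R]_k).

Definition Udir theta V x : 'cV[R]_k :=
  if x == theta then 0
  else (enorm (isqrtmx V *m (x - theta)))^-1 *: (isqrtmx V *m (x - theta)).

Definition Wvec theta V x : 'cV[R]_(k * k) :=
  vec (Udir theta V x *m (Udir theta V x)^T - k%:R^-1 *: 1%:M).

Definition depth theta V (P : probability (borel_cV R k) R) : \bar R :=
  ereal_inf [set P [set x : 'cV[R]_k | 0 <= dotv u (Wvec theta V x)]
            | u in sphere R (k * k)].

Definition max_hyperplane_mass theta (P : probability (borel_cV R k) R) :
    \bar R :=
  ereal_sup [set P [set x : 'cV[R]_k | dotv u (x - theta) = 0]
            | u in sphere R k].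

Definition depth_region theta (alpha : R) (P : probability (borel_cV R k) R) :
    set (shape_matrix R k) :=
  [set V : shape_matrix R k | (alpha%:E <= depth theta V P)%E].

End depth.

(* Main.v *)
Require Import Defs.
From mathcomp Require Import all_boot all_order all_algebra.
From mathcomp Require Import all_classical all_reals all_analysis.
From mathcomp Require Import ring lra.

(** Write [y = V^{-1/2} (x - theta)].  The infimum over [u = vec A] in the
    definition of the depth compares [P (tr A / k |y|^2 <= y^T A y)] with
    [alpha].  Two facts carry the proof.

    The region stays away from singular matrices.  The choice [A = V], for
    which [tr A = k] and [y^T A y = |x - theta|^2], gives the event
    [|y| <= |x - theta|].  As [v^T (x - theta) = (V^{1/2} v)^T y], the
    Cauchy-Schwarz inequality puts this event inside
    [(v^T (x - theta))^2 <= (v^T V v) |x - theta|^2] for every unit vector [v].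
    When [e] tends to [0], the events
    [(v^T (x - theta))^2 <= e |x - theta|^2] shrink to a hyperplane, of
    probability less than [alpha]; by semicontinuity and compactness of the
    sphere, some [e > 0] makes them all of probability less than [alpha]
    ([flat_event_lt]).  Hence [v^T V v > e] for every unit [v] and every [V] in
    the region ([depth_region_coercive]); the trace bounds [V] from above, so
    the spectrum of [V] lies in a fixed compact subset of [(0, +oo)] and the
    geodesic distance to the identity is bounded ([geo_bounded_pair_shape]).

    The depth is upper semicontinuous.  If a point lies outside the depth event
    of [V^{-1/2}], it lies outside that of every nearby matrix, so the
    probability of the event is upper semicontinuous in [V^{-1/2}]
    ([near_probability_lt]).  Therefore the pairs [(V^{1/2}, V^{-1/2})] coming
    from the region form a closed bounded set of pairs of matrices
    ([compact_deep_pairs]).  The region is the image of this compact set under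
    [(S, J) |-> S S], which is continuous for the geodesic topology because
    [log (V^{-1/2} W V^{-1/2})] is small when [W] is entrywise close to [V]
    ([near_geodist]). *)

Set Implicit Arguments.
Unset Strict Implicit.
Unset Printing Implicit Defensive.
Import Order.TTheory GRing.Theory Num.Theory.
Import numFieldNormedType.Exports.
Local Open Scope classical_set_scope.
Local Open Scope ring_scope.

(** * Euclidean linear algebra *)

Section dot_product.
Context {R : realType}.

Lemma dotvE m (u v : 'cV[R]_m) : dotv u v = \sum_i u i 0 * v i 0.
Proof. by rewrite /dotv mxE; apply: eq_bigr => i _; rewrite mxE. Qed.

Lemma dotvC m (u v : 'cV[R]_m) : dotv u v = dotv v u.
Proof. by rewrite !dotvE; apply: eq_bigr => i _; rewrite mulrC. Qed.

Lemma dotvDr m (u v w : 'cV[R]_m) : dotv u (v + w) = dotv u v + dotv u w.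
Proof. by rewrite /dotv mulmxDr mxE. Qed.

Lemma dotvZr m (u v : 'cV[R]_m) a : dotv u (a *: v) = a * dotv u v.
Proof. by rewrite /dotv -scalemxAr mxE. Qed.

Lemma dotvBr m (u v w : 'cV[R]_m) : dotv u (v - w) = dotv u v - dotv u w.
Proof. by rewrite dotvDr -scaleN1r dotvZr mulN1r. Qed.

Lemma dotvBl m (u v w : 'cV[R]_m) : dotv (v - w) u = dotv v u - dotv w u.
Proof. by rewrite dotvC dotvBr !(dotvC u). Qed.

Lemma dotvZl m (u v : 'cV[R]_m) a : dotv (a *: u) v = a * dotv u v.
Proof. by rewrite dotvC dotvZr dotvC. Qed.

Lemma dotv0 m (u : 'cV[R]_m) : dotv u 0 = 0.
Proof. by rewrite /dotv mulmx0 mxE. Qed.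

Lemma dotv_ge0 m (u : 'cV[R]_m) : 0 <= dotv u u.
Proof. by rewrite dotvE sumr_ge0// => i _; rewrite -expr2 sqr_ge0. Qed.

Lemma sqr_coord_le_dotv m (u : 'cV[R]_m) i : u i 0 ^+ 2 <= dotv u u.
Proof.
rewrite dotvE (bigD1 i)//= -expr2 lerDl sumr_ge0// => j _.
by rewrite -expr2 sqr_ge0.
Qed.

Lemma dotv_eq0 m (u : 'cV[R]_m) : (dotv u u == 0) = (u == 0).
Proof.
apply/eqP/eqP => [u0|->]; last exact: dotv0.
apply/colP => i; rewrite mxE; apply/eqP; rewrite -sqrf_eq0 eq_le sqr_ge0 andbT.
by rewrite -u0 sqr_coord_le_dotv.
Qed.

Lemma dotv_gt0 m (u : 'cV[R]_m) : (0 < dotv u u) = (u != 0).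
Proof. by rewrite lt_def dotv_eq0 dotv_ge0 andbT. Qed.

Lemma sqr_enorm m (u : 'cV[R]_m) : enorm u ^+ 2 = dotv u u.
Proof.
rewrite /enorm sqr_sqrtr; last by rewrite sumr_ge0// => i _; exact: sqr_ge0.
by rewrite dotvE; apply: eq_bigr => i _; rewrite expr2.
Qed.

Lemma enorm_eq0 m (u : 'cV[R]_m) : (enorm u == 0) = (u == 0).
Proof. by rewrite -sqrf_eq0 sqr_enorm dotv_eq0. Qed.

Lemma sphereP m (u : 'cV[R]_m) : sphere R m u <-> dotv u u = 1.
Proof.
rewrite -sqr_enorm; split => [->|u1]; first by rewrite expr1n.
have e0 : 0 <= enorm u by rewrite sqrtr_ge0.
by apply/eqP; rewrite -[_ == 1](@eqrXn2 _ 2)// u1 expr1n.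
Qed.

Lemma sphere_normalize m (u : 'cV[R]_m) :
  u != 0 -> sphere R m ((enorm u)^-1 *: u).
Proof.
move=> u0; apply/sphereP; rewrite dotvZl dotvZr -sqr_enorm expr2 mulrA.
by rewrite mulrACA mulVf ?mul1r ?mulVf// enorm_eq0.
Qed.

Lemma dotv_cauchy_schwarz m (u v : 'cV[R]_m) :
  dotv u v ^+ 2 <= dotv u u * dotv v v.
Proof.
have [->|v0] := eqVneq v 0; first by rewrite !dotv0 expr0n mulr0.
have v1 : 0 < dotv v v by rewrite dotv_gt0.
have := dotv_ge0 (dotv v v *: u - dotv u v *: v).
rewrite dotvBr !dotvBl !dotvZl !dotvZr (dotvC v u).
rewrite (_ : _ - _ = dotv v v * (dotv u u * dotv v v - dotv u v ^+ 2)).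
  by rewrite pmulr_rge0// subr_ge0.
by ring.
Qed.

Lemma dotv_mulmxl m n (A : 'M[R]_(m, n)) u v :
  dotv (A *m u) v = dotv u (A^T *m v).
Proof. by rewrite /dotv trmx_mul mulmxA. Qed.

Lemma dotv_row_col m (u : 'rV[R]_m) (v : 'cV[R]_m) : dotv u^T v = (u *m v) 0 0.
Proof. by rewrite /dotv trmxK. Qed.

Lemma trace_mul_tr m n (A : 'M[R]_(m, n)) :
  \tr (A^T *m A) = \sum_j dotv (col j A) (col j A).
Proof.
rewrite /mxtrace; apply: eq_bigr => j _; rewrite mxE dotvE.
by apply: eq_bigr => i _; rewrite !mxE.
Qed.

Lemma trace_conj m n (A : 'M[R]_(m, n)) (B : 'M[R]_m) :
  \tr (A^T *m B *m A) = \sum_j dotv (col j A) (B *m col j A).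
Proof.
rewrite /mxtrace; apply: eq_bigr => j _; rewrite -mulmxA mxE dotvE.
apply: eq_bigr => i _; rewrite !mxE; congr (_ * _).
by apply: eq_bigr => l _; rewrite !mxE.
Qed.

(** The operator norm is at most the Frobenius norm. *)
Lemma dotv_mulmx_le_trace m n (A : 'M[R]_(m, n)) v :
  dotv (A *m v) (A *m v) <= \tr (A *m A^T) * dotv v v.
Proof.
have -> : \tr (A *m A^T) = \sum_i dotv (row i A)^T (row i A)^T.
  rewrite -{1}[A]trmxK trace_mul_tr; apply: eq_bigr => i _.
  by rewrite tr_row.
rewrite dotvE mulr_suml ler_sum// => i _; rewrite -expr2.
suff -> : (A *m v) i 0 = dotv (row i A)^T v by exact: dotv_cauchy_schwarz.
by rewrite dotv_row_col -row_mul [RHS]mxE.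
Qed.

(** Entries of size at most [e] yield a quadratic form of size at most
    [m * e]. *)
Lemma quad_form_le m (A : 'M[R]_m) e v :
  (forall i j, `|A i j| <= e) ->
  `|dotv v (A *m v)| <= m%:R * e * dotv v v.
Proof.
case: m A v => [|m] A v Ae.
  by rewrite dotvE big_ord0 normr0 mul0r mul0r.
have e0 : 0 <= e by apply: le_trans (Ae 0 0).
rewrite dotvE; apply: (@le_trans _ _ (\sum_i \sum_j
    e * ((v i 0 ^+ 2 + v j 0 ^+ 2) / 2))).
  apply: le_trans (ler_norm_sum _ _ _) _; apply: ler_sum => i _.
  rewrite mxE mulr_sumr; apply: le_trans (ler_norm_sum _ _ _) _.
  apply: ler_sum => j _; rewrite !normrM mulrCA.
  apply: ler_pM; rewrite ?mulr_ge0 ?Ae//.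
  rewrite -[v i 0 ^+ 2]real_normK ?num_real// -[v j 0 ^+ 2]real_normK ?num_real//.
  by have := sqr_ge0 (`|v i 0| - `|v j 0|); nra.
rewrite le_eqVlt; apply/orP; left; apply/eqP.
under eq_bigr do rewrite -mulr_sumr -mulr_suml big_split/=.
rewrite -mulr_sumr -mulr_suml big_split/= sumr_const card_ord.
under eq_bigr do rewrite sumr_const card_ord.
rewrite -sumrMnl sumrMnl -mulr2n dotvE.
under [in RHS]eq_bigr do rewrite -expr2.
by rewrite -[in LHS]mulr_natl -[_ *+ m.+1]mulr_natl; field.
Qed.

Lemma dotv_vec k (A B : 'M[R]_k) : dotv (vec A) (vec B) = \tr (A^T *m B).
Proof.
rewrite dotvE /vec (reindex _ (curry_mxvec_bij k k))/=.
transitivity (\sum_i \sum_j A j i * B j i).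
  rewrite pair_bigA/=; apply: eq_bigr => -[i j] _ /=.
  by rewrite !mxE /= !mxvecE !mxE.
by apply: eq_bigr => i _; rewrite mxE; apply: eq_bigr => j _; rewrite mxE.
Qed.

Lemma vecB k (A B : 'M[R]_k) : vec (A - B) = vec A - vec B.
Proof. by rewrite /vec !linearB. Qed.

Lemma vecZ k a (A : 'M[R]_k) : vec (a *: A) = a *: vec A.
Proof. by rewrite /vec !linearZ. Qed.

Lemma vec_eq0 k (A : 'M[R]_k) : (vec A == 0) = (A == 0).
Proof.
apply/eqP/eqP => [|->]; last by rewrite /vec !linear0.
by move=> /(congr1 trmx); rewrite trmxK linear0 => /eqP; rewrite mxvec_eq0
  -trmx0 => /eqP/(congr1 trmx); rewrite !trmxK trmx0.
Qed.

End dot_product.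

Section positive_definite.
Context {R : realType}.

(** A nonnegative quadratic form vanishes only on the kernel: otherwise it
    would be negative at [v - t S v] for small [t > 0]. *)
Lemma psd_kernel k (S : 'M[R]_k) v : S^T = S ->
  (forall w, 0 <= dotv w (S *m w)) -> dotv v (S *m v) = 0 -> S *m v = 0.
Proof.
move=> ST psd v0; set w := S *m v; apply/eqP; rewrite -dotv_eq0 eq_le.
rewrite dotv_ge0 andbT.
set C := dotv w (S *m w); have C0 : 0 <= C by exact: psd.
set n := dotv w w; have n0 : 0 <= n by exact: dotv_ge0.
have H t : 0 <= - (2 * t * n) + t ^+ 2 * C.
  have := psd (v - t *: w).
  rewrite mulmxBr -scalemxAr -/w dotvBr !dotvBl !dotvZr !dotvZl.
  have -> : dotv v (S *m w) = n by rewrite /n {1}/w dotv_mulmxl ST.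
  rewrite v0 -/C -/n; set X := (X in 0 <= X -> _); set Y := (Y in _ -> 0 <= Y).
  by suff -> : X = Y by []; rewrite /X /Y; ring.
(* the minimizer is t = n / C; the denominator is shifted to cover C = 0 *)
have := H (n / (C + 1)); have C1 : 0 < C + 1 by rewrite ltr_wpDl.
set t := n / (C + 1); have tn : t * (C + 1) = n by rewrite divfK// gt_eqF.
have t0 : 0 <= t by rewrite divr_ge0// ltW.
clearbody t; move: tn t0 C0 n0 C1; clear; nra.
Qed.

Lemma posdef_quad k (S : 'M[R]_k) :
  posdef S <-> S^T = S /\ forall v, v != 0 -> 0 < dotv v (S *m v).
Proof.
split=> -[ST pS]; split => // v v0; have := pS v v0.
  by rewrite -mulmxA.
by rewrite /dotv mulmxA.
Qed.

Lemma posdef_ge0 k (S : 'M[R]_k) v : posdef S -> 0 <= dotv v (S *m v).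
Proof.
move=> /posdef_quad[_ pS]; have [->|v0] := eqVneq v 0.
  by rewrite mulmx0 dotv0.
exact/ltW/pS.
Qed.

Lemma unitmx_kernel k (S : 'M[R]_k) :
  (forall v : 'cV[R]_k, S *m v = 0 -> v = 0) -> S \in unitmx.
Proof.
move=> S0; rewrite -unitmx_tr -row_free_unit -kermx_eq0; apply/eqP/row_matrixP => i.
rewrite row0; apply: trmx_inj; rewrite trmx0; apply: S0; apply: trmx_inj.
by rewrite trmx_mul trmxK -row_mul mulmx_ker row0 trmx0.
Qed.

Lemma posdef_unitmx k (S : 'M[R]_k) : posdef S -> S \in unitmx.
Proof.
move=> /posdef_quad[_ pS]; apply: unitmx_kernel => v Sv.
by apply/eqP; apply: contraT => /pS; rewrite Sv dotv0 ltxx.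
Qed.

(** Uniqueness of the positive definite square root: if [D = S - T] then
    [S D + D T = 0], whence [tr (D S D) + tr (D T D) = 0]. *)
Lemma posdef_sqrt_inj k (S T : 'M[R]_k) : posdef S -> posdef T ->
  S *m S = T *m T -> S = T.
Proof.
move=> pS pT ST; apply/eqP; rewrite -subr_eq0; set D := S - T.
have DT : D^T = D by rewrite linearB/= (proj1 pS) (proj1 pT).
have SD : S *m D + D *m T = 0.
  by rewrite mulmxBl mulmxBr addrA subrK ST subrr.
have tr0 : \tr (D^T *m S *m D) + \tr (D^T *m T *m D) = 0.
  rewrite DT -!mulmxA [\tr (D *m (T *m D))]mxtrace_mulC -mulmxA.
  rewrite [\tr (T *m _)]mxtrace_mulC -mulmxA -linearD/= -mulmxDr SD.
  by rewrite mulmx0 linear0.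
have nn (A : 'M[R]_k) : posdef A -> 0 <= \tr (D^T *m A *m D).
  by move=> pA; rewrite trace_conj sumr_ge0// => j _; exact: posdef_ge0.
have : \tr (D^T *m S *m D) = 0 by have := nn _ pS; have := nn _ pT; lra.
rewrite trace_conj => /eqP; rewrite psumr_eq0; last by move=> j _; exact: posdef_ge0.
move=> /allP D0; apply/eqP/matrixP => i j.
have := D0 j (mem_index_enum _); move: pS => /posdef_quad[_ pS].
have [cj _|/pS] := eqVneq (col j D) 0; last by rewrite lt_def => /andP[/negbTE->].
by have := congr1 (fun M : 'cV_k => M i 0) cj; rewrite !mxE.
Qed.

Lemma sqrtmx_eq k (S : 'M[R]_k) : posdef S -> sqrtmx (S *m S) = S.
Proof.
move=> pS; rewrite /sqrtmx; case: xgetP => [T -> [pT TT]|].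
  exact: posdef_sqrt_inj.
by move=> /(_ S)[].
Qed.

End positive_definite.

Section geodesic_bound.
Context {R : realType}.

(** Eigenvalue bounds control the logarithm.  No diagonalizability is needed:
    the default value of [logmx] has norm zero. *)
Lemma frobenius_logmx_le k (M : 'M[R]_k) c : 0 <= c ->
  (forall v, expR (- c) * dotv v v <= dotv v (M *m v) <= expR c * dotv v v) ->
  frobenius (logmx M) <= Num.sqrt k%:R * c.
Proof.
move=> c0 Mc; rewrite /logmx; case: xgetP => [L -> [Q [l [QQ l0 ME ->]]]|_]; last first.
  by rewrite /frobenius mul0mx linear0 sqrtr0 mulr_ge0 ?sqrtr_ge0.
have QQ' : Q^T *m Q = 1%:M by apply: mulmx1C.
have lE i : l 0 i = dotv (col i Q) (M *m col i Q).
  transitivity ((Q^T *m M *m Q) i i).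
    by rewrite ME !mulmxA QQ' mul1mx -mulmxA QQ' mulmx1 !mxE eqxx.
  rewrite -mulmxA mxE dotvE; apply: eq_bigr => j _; rewrite !mxE; congr (_ * _).
  by apply: eq_bigr => h _; rewrite !mxE.
have q1 i : dotv (col i Q) (col i Q) = 1.
  transitivity ((Q^T *m Q) i i); last by rewrite QQ' mxE eqxx.
  by rewrite mxE dotvE; apply: eq_bigr => j _; rewrite !mxE.
have lnc i : (ln (l 0 i)) ^+ 2 <= c ^+ 2.
  have /andP[l1 l2] := Mc (col i Q); rewrite -lE q1 !mulr1 in l1 l2.
  rewrite -[leLHS]real_normK ?num_real// ler_sqr ?nnegrE// ler_norml.
  by rewrite -[- c]expRK -[X in _ && (_ <= X)]expRK !ler_ln ?posrE ?expR_gt0// l1.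
rewrite /frobenius -[leRHS]ger0_norm ?mulr_ge0 ?sqrtr_ge0//.
rewrite -sqrtr_sqr exprMn sqr_sqrtr ?ler0n//; apply: ler_wsqrtr.
set d := map_mx _ l; rewrite !trmx_mul trmxK tr_diag_mx !mulmxA mxtrace_mulC.
rewrite !mulmxA QQ' mul1mx.
rewrite -[_ *m Q^T *m Q]mulmxA QQ' mulmx1 mulmx_diag mxtrace_diag.
rewrite mulr_natl -[in leRHS](card_ord k) -sumr_const ler_sum// => i _.
by rewrite !mxE -expr2.
Qed.

End geodesic_bound.

(** * Topology of matrix spaces *)

Section matrix_topology.
Context {R : realType}.

Lemma cvg_mx {T : Type} {F : set_system T} {FF : Filter F} m n
    (f : T -> 'M[R]_(m, n)) (M : 'M[R]_(m, n)) :
  (forall i j, (fun t => f t i j) @ F --> M i j) -> f @ F --> M.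
Proof.
move=> fM A [B BM BA]; apply: filterS.
  by move=> t; exact: BA.
by apply: filter_forall => i; apply: filter_forall => j; exact: fM (BM i j).
Qed.

Lemma cvg_coord {T : Type} {F : set_system T} {FF : Filter F} m n
    (f : T -> 'M[R]_(m, n)) (M : 'M[R]_(m, n)) i j :
  f @ F --> M -> (fun t => f t i j) @ F --> M i j.
Proof. by move=> fM; exact: cvg_comp fM (@coord_continuous _ _ _ i j M). Qed.

Lemma cvg_sumr {T I : Type} {F : set_system T} {FF : Filter F} (r : seq I)
    (f : I -> T -> R) (l : I -> R) :
  (forall i, f i @ F --> l i) ->
  (fun t => \sum_(i <- r) f i t) @ F --> \sum_(i <- r) l i.
Proof. by move=> fl; apply: cvg_big => //; exact: add_continuous. Qed.

Lemma cvg_mulmx {T : Type} {F : set_system T} {FF : Filter F} m n p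
    (f : T -> 'M[R]_(m, n)) (g : T -> 'M[R]_(n, p))
    (A : 'M[R]_(m, n)) (B : 'M[R]_(n, p)) :
  f @ F --> A -> g @ F --> B -> (fun t => f t *m g t) @ F --> A *m B.
Proof.
move=> fA gB; apply: cvg_mx => i j; rewrite mxE.
under eq_fun do rewrite mxE.
by apply: cvg_sumr => h; apply: cvgM; exact: cvg_coord.
Qed.

Lemma cvg_trmx {T : Type} {F : set_system T} {FF : Filter F} m n
    (f : T -> 'M[R]_(m, n)) (A : 'M[R]_(m, n)) :
  f @ F --> A -> (fun t => (f t)^T) @ F --> A^T.
Proof.
move=> fA; apply: cvg_mx => i j; rewrite mxE.
by under eq_fun do rewrite mxE; exact: cvg_coord.
Qed.

Lemma cvg_mxtrace {T : Type} {F : set_system T} {FF : Filter F} m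
    (f : T -> 'M[R]_m) (A : 'M[R]_m) :
  f @ F --> A -> (fun t => \tr (f t)) @ F --> \tr A.
Proof. by move=> fA; apply: cvg_sumr => i; exact: cvg_coord. Qed.

Lemma cvg_dotv {T : Type} {F : set_system T} {FF : Filter F} m
    (f g : T -> 'cV[R]_m) (u v : 'cV[R]_m) :
  f @ F --> u -> g @ F --> v ->
  (fun t => dotv (f t) (g t)) @ F --> dotv u v.
Proof.
by move=> fu gv; apply: cvg_coord; apply: cvg_mulmx => //; exact: cvg_trmx.
Qed.

Lemma closed_forall {T : topologicalType} {I : Type} (A : I -> set T) :
  (forall i, closed (A i)) -> closed [set x | forall i, A i x].
Proof.
move=> cA; rewrite (_ : mkset _ = \bigcap_i A i); first exact: closed_bigI.
by apply/seteqP; split => x Ax i; [move=> _; exact: Ax | exact: Ax].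
Qed.

Lemma closed_fun_le {T : topologicalType} (f g : T -> R) :
  continuous f -> continuous g -> closed [set x | f x <= g x].
Proof.
move=> cf cg.
rewrite (_ : mkset _ = (fun x => g x - f x) @^-1` [set y | 0 <= y]).
  apply: closed_comp; last exact: closed_ge.
  by move=> x _; apply: cvgB; [exact: cg|exact: cf].
by apply/seteqP; split => x /=; rewrite subr_ge0.
Qed.

Lemma closed_mx_eq {T : topologicalType} m n (f g : T -> 'M[R]_(m, n)) :
  continuous f -> continuous g -> closed [set x | f x = g x].
Proof.
move=> cf cg; rewrite (_ : mkset _ = [set x | forall ij : 'I_m * 'I_n,
    [set x | f x ij.1 ij.2 <= g x ij.1 ij.2] x /\
    [set x | g x ij.1 ij.2 <= f x ij.1 ij.2] x]); last first.
  apply/seteqP; split => x /= => [-> //|fg].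
  by apply/matrixP => i j; apply/le_anti/andP; exact: (fg (i, j)).
have cc (h : T -> 'M[R]_(m, n)) i j : continuous h -> continuous (fun x => h x i j).
  by move=> ch x; apply: (@cvg_coord _ (nbhs x)); exact: ch.
by apply: closed_forall => -[i j]; apply: closedI; apply: closed_fun_le; exact: cc.
Qed.

Lemma compact_mx_box m n (C : R) :
  compact [set A : 'M[R]_(m, n) | forall i j, `|A i j| <= C].
Proof.
set B := [set v : 'rV[R]_(m * n) | forall i, `[- C, C]%classic (v ord0 i)].
have cB : compact B.
  by apply: (@rV_compact _ _ (fun=> `[- C, C]%classic)) => _; exact: segment_compact.
have := @continuous_compact _ _ (vec_mx : 'rV[R]_(m * n) -> 'M[R]_(m, n)) B _ cB.
rewrite (_ : vec_mx @` B = [set A : 'M[R]_(m, n) | forall i j, `|A i j| <= C]).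
  apply; apply: continuous_subspaceT => v.
  apply: (@cvg_mx _ (nbhs v)) => i j; rewrite mxE.
  by under eq_fun do rewrite mxE; exact: coord_continuous.
apply/seteqP; split => [_ [v vB <-] i j|A AC].
  by rewrite mxE ler_norml; have := vB (mxvec_index i j); rewrite /= in_itv.
exists (mxvec A); last by rewrite mxvecK.
move=> h /=; case/mxvec_indexP: h => i j; rewrite [mxvec A _ _]mxvecE.
by rewrite in_itv/= -ler_norml.
Qed.

Lemma compact_sphere m : compact (sphere R m).
Proof.
apply: (subclosed_compact _ (@compact_mx_box m 1 1)).
  rewrite (_ : sphere R m = [set u | dotv u u <= 1] `&` [set u | 1 <= dotv u u]).
    have c : continuous (fun u : 'cV[R]_m => dotv u u).
      by move=> u; apply: (@cvg_dotv _ (nbhs u)); exact: cvg_id.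
    by apply: closedI; apply: closed_fun_le => //; exact: cst_continuous.
  apply/seteqP; split => u /=; first by move=> /sphereP ->.
  by move=> [u1 u2]; apply/sphereP/le_anti/andP.
move=> u /sphereP u1 i j; rewrite ord1 -[leRHS]ger0_norm//.
by rewrite -ler_sqr ?nnegrE// !real_normK ?num_real// expr1n -u1 sqr_coord_le_dotv.
Qed.

End matrix_topology.

(** * Semicontinuity of probabilities *)

Section semicontinuity.
Context {R : realType}.

(** If every point outside [E s0] stays outside [E s] for [s] near [s0], then
    the upper limit of the sets [E s] is contained in [E s0], and Fatou's lemma
    makes [s |-> P (E s)] upper semicontinuous at [s0]. *)
Lemma near_probability_lt d (T : measurableType d) (P : probability T R)
    (X : pseudoMetricType R) (E : X -> set T) (s0 : X) (a : \bar R) :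
  (forall s, measurable (E s)) ->
  (forall x, ~ E s0 x -> \forall s \near s0, ~ E s x) ->
  (P (E s0) < a)%E -> \forall s \near s0, (P (E s) < a)%E.
Proof.
move=> mE Ex Pa; apply: contrapT => nPa.
have /choice[s sP] (n : nat) :
    exists s, ball s0 n.+1%:R^-1 s /\ (a <= P (E s))%E.
  apply: contrapT => ns; apply: nPa; apply/nbhs_ballP.
  exists n.+1%:R^-1 => /=; first by rewrite invr_gt0.
  by move=> t st; rewrite ltNge; apply/negP => at_; apply: ns; exists t.
pose B n := \bigcup_(j in [set j | (n <= j)%N]) E (s j).
have mB n : measurable (B n) by apply: bigcup_measurable => j _; exact: mE.
have aB n : (a <= P (B n))%E.
  apply: le_trans (proj2 (sP n)) _; apply: le_measure; rewrite ?inE//.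
  by move=> x Ex'; exists n => /=.
have mBB : measurable (\bigcap_n B n) by apply: bigcapT_measurable.
have BE : \bigcap_n B n `<=` E s0.
  move=> x Bx; apply: contrapT => /Ex/nbhs_ballP[e /= e0 eE].
  have [n ne] : exists n : nat, n.+1%:R^-1 < e.
    exists (Num.Def.trunc e^-1); rewrite invf_plt ?posrE//.
    exact: truncnS_gt.
  have [j /= nj Ej] := Bx n I; apply: eE Ej.
  apply: le_ball (proj1 (sP j)); apply: le_trans (ltW ne).
  by rewrite lef_pV2 ?posrE// ler_nat.
have cB : P \o B @ \oo --> P (\bigcap_n B n).
  apply: nonincreasing_cvg_mu => //.
    by apply: le_lt_trans (probability_le1 _ _) _ => //; exact: ltry.
  move=> m n mn; apply/subsetPset => x [j /= nj Ej]; exists j => //=.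
  exact: leq_trans nj.
have : (a <= P (\bigcap_n B n))%E.
  apply: (@closed_cvg _ _ \oo _ (P \o B) [set y | (a <= y)%E]) cB.
  - exact: closed_ereal_le_ereal.
  - by apply: nearW => n; exact: aB.
apply/negP; rewrite -ltNge; apply: le_lt_trans Pa.
by apply: le_measure => //; rewrite inE.
Qed.

Lemma borel_cV_measurable_closed m (A : set 'cV[R]_m) : closed A ->
  measurable (A : set (borel_cV R m)).
Proof.
move=> cA; rewrite -[A]setCK; apply: measurableC.
by apply: sub_sigma_algebra; exact: closed_openC.
Qed.

End semicontinuity.

(** * Depth events *)

Section depth_events.
Context {R : realType} {k : nat}.
Implicit Types (theta x v : 'cV[R]_k) (A J S V : 'M[R]_k).

(** The event [0 <= u^T W] for [u = vec A] and [V^{-1/2} = J], cleared of the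
    normalization: with [y = J (x - theta)], it reads
    [(tr A / k) |y|^2 <= y^T A y] when [y] is nonzero, and [tr A <= 0] when
    [y = 0]. *)
Definition quad_event theta A J : set 'cV[R]_k :=
  [set x | let y := J *m (x - theta) in
    k%:R^-1 * \tr A * dotv y y <= dotv y (A *m y) /\ (y = 0 -> \tr A <= 0)].

Lemma dotv_vec_dyad A v : dotv (vec A) (vec (v *m v^T)) = dotv v (A *m v).
Proof.
rewrite dotv_vec mulmxA mxtrace_mulC /mxtrace big_ord1.
by rewrite dotvC dotv_mulmxl /dotv mulmxA.
Qed.

Lemma depth_eventE theta A V : (0 < k)%N ->
  [set x | 0 <= dotv (vec A) (Wvec theta V x)] =
  quad_event theta A (isqrtmx V).
Proof.
move=> k0; have kR : 0 < k%:R :> R by rewrite ltr0n.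
rewrite /quad_event; set J := isqrtmx V.
apply/seteqP; suff H x : 0 <= dotv (vec A) (Wvec theta V x) <->
    quad_event theta A J x by split => x /= /H.
rewrite /quad_event /= /Wvec vecB dotvBr dotv_vec_dyad vecZ dotvZr dotv_vec.
rewrite mulmx1 mxtrace_tr /Udir -/J; set y := J *m (x - theta).
have -> : (if x == theta then 0 else (enorm y)^-1 *: y) = (enorm y)^-1 *: y.
  by case: eqP => // xt; rewrite /y xt subrr mulmx0 scaler0.
rewrite -scalemxAr dotvZl dotvZr.
have [->|y0] := eqVneq y 0.
  rewrite dotv0 mulmx0 dotv0 !mulr0 sub0r oppr_ge0 pmulr_rle0 ?invr_gt0//.
  by split => [tA|[_ ->]//]; split.
have N0 : 0 < dotv y y by rewrite dotv_gt0.
rewrite mulrA -expr2 exprVn sqr_enorm subr_ge0 ler_pdivlMl// mulrC.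
by split => [?|[]//]; split => // /eqP; rewrite (negbTE y0).
Qed.

Lemma measurable_quad_event theta A J :
  measurable (quad_event theta A J : set (borel_cV R k)).
Proof.
have cy : continuous (fun x : 'cV[R]_k => J *m (x - theta)).
  move=> x; apply: (@cvg_mulmx _ _ (nbhs x)); first exact: cvg_cst.
  by apply: (@cvgB _ _ _ (nbhs x)); [exact: cvg_id|exact: cvg_cst].
rewrite (_ : quad_event _ _ _ = [set x |
    k%:R^-1 * \tr A * dotv (J *m (x - theta)) (J *m (x - theta)) <=
    dotv (J *m (x - theta)) (A *m (J *m (x - theta)))] `&`
    ~` ([set x | J *m (x - theta) = 0] `&` [set x | ~ (\tr A <= 0)])); last first.
  apply/seteqP; split => x /= -[H1 H2]; split => //.
    by move=> -[/H2].
  by move=> y0; apply: contrapT => tA; apply: H2.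
apply: measurableI; first apply: borel_cV_measurable_closed.
  apply: closed_fun_le => x.
    apply: (@cvgM _ _ (nbhs x)); first exact: cvg_cst.
    by apply: (@cvg_dotv _ _ (nbhs x)); exact: cy.
  apply: (@cvg_dotv _ _ (nbhs x)); first exact: cy.
  by apply: (@cvg_mulmx _ _ (nbhs x)); [exact: cvg_cst|exact: cy].
apply: measurableC; apply: measurableI; apply: borel_cV_measurable_closed.
  by apply: closed_mx_eq => //; exact: cst_continuous.
have [tA|tA] := pselect (\tr A <= 0).
  by rewrite (_ : mkset _ = set0); [exact: closed0|apply/seteqP; split => ?].
by rewrite (_ : mkset _ = setT); [exact: closedT|apply/seteqP; split => ?].
Qed.

Lemma near_notin_quad_event theta A J x : J \in unitmx ->
  ~ quad_event theta A J x -> \forall L \near J, ~ quad_event theta A L x.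
Proof.
move=> uJ nx; have [xt|xt] := eqVneq x theta.
  apply: (@nearW _ (nbhs J)) => L [_ H]; apply: nx; split.
    by rewrite xt subrr !mulmx0 dotv0 mulr0.
  by move=> _; apply: H; rewrite xt subrr mulmx0.
set F := fun L : 'M[R]_k => dotv (L *m (x - theta)) (A *m (L *m (x - theta))) -
  k%:R^-1 * \tr A * dotv (L *m (x - theta)) (L *m (x - theta)).
have FJ : F J < 0.
  rewrite subr_lt0 ltNge; apply/negP => H; apply: nx; split => //= y0.
  have : x - theta = 0 by rewrite -(mulKmx uJ (x - theta)) y0 mulmx0.
  by move/eqP; rewrite subr_eq0 (negbTE xt).
have cL : (fun L : 'M[R]_k => L *m (x - theta)) @ J --> J *m (x - theta).
  by apply: (@cvg_mulmx _ _ (nbhs J)); [exact: cvg_id|exact: cvg_cst].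
have cF : F @ J --> F J.
  apply: (@cvgB _ _ _ (nbhs J)); last first.
    apply: (@cvgM _ _ (nbhs J)); first exact: cvg_cst.
    exact: (@cvg_dotv _ _ (nbhs J)).
  apply: (@cvg_dotv _ _ (nbhs J)) => //.
  by apply: (@cvg_mulmx _ _ (nbhs J)); [exact: cvg_cst|].
have := cvgr_lt _ cF _ FJ => /(_ _); apply: (@filterS _ (nbhs J)) => L.
by rewrite subr_lt0 ltNge => /negP nF [/nF].
Qed.

(** The event that the direction of [x - theta] is nearly orthogonal to [v]. *)
Definition flat_event theta (p : 'cV[R]_k * R) : set 'cV[R]_k :=
  [set x | dotv p.1 (x - theta) ^+ 2 <= p.2 * dotv (x - theta) (x - theta)].

Lemma measurable_flat_event theta p :
  measurable (flat_event theta p : set (borel_cV R k)).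
Proof.
have c : continuous (fun x : 'cV[R]_k => x - theta).
  by move=> x; apply: (@cvgB _ _ _ (nbhs x)); [exact: cvg_id|exact: cvg_cst].
apply: borel_cV_measurable_closed; apply: closed_fun_le => x.
  rewrite /continuous_at; under eq_fun do rewrite expr2; rewrite expr2.
  by apply: (@cvgM _ _ (nbhs x)); apply: (@cvg_dotv _ _ (nbhs x));
    [exact: cvg_cst|exact: c|exact: cvg_cst|exact: c].
apply: (@cvgM _ _ (nbhs x)); first exact: cvg_cst.
by apply: (@cvg_dotv _ _ (nbhs x)); exact: c.
Qed.

Lemma near_notin_flat_event theta p x :
  ~ flat_event theta p x -> \forall q \near p, ~ flat_event theta q x.
Proof.
move=> np; set F := fun q : 'cV[R]_k * R =>
  q.2 * dotv (x - theta) (x - theta) - dotv q.1 (x - theta) ^+ 2.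
have Fp : F p < 0 by rewrite subr_lt0 ltNge; apply/negP.
have cF : F @ p --> F p.
  apply: (@cvgB _ _ _ (nbhs p)).
    by apply: (@cvgM _ _ (nbhs p)); [exact: cvg_snd|exact: cvg_cst].
  rewrite expr2; under eq_fun do rewrite expr2.
  by apply: (@cvgM _ _ (nbhs p)); apply: (@cvg_dotv _ _ (nbhs p));
    [exact: cvg_fst|exact: cvg_cst|exact: cvg_fst|exact: cvg_cst].
have := cvgr_lt _ cF _ Fp => /(_ _); apply: (@filterS _ (nbhs p)) => q.
by rewrite subr_lt0 ltNge => /negP.
Qed.

(** Flat events are uniformly small: this is where the hyperplane bound enters,
    through compactness of the sphere. *)
Lemma flat_event_lt theta (P : probability (borel_cV R k) R) (alpha : R) :
  (max_hyperplane_mass theta P < alpha%:E)%E ->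
  exists2 e : R, 0 < e &
    forall v, sphere R k v -> (P (flat_event theta (v, e)) < alpha%:E)%E.
Proof.
move=> Pa.
have /compact_near_coveringP cov := @compact_sphere R k.
have := cov R (nbhs (0 : R)) (fun e v =>
  (P (flat_event theta (v, e)) < alpha%:E)%E) _ _.
case.
- move=> v v1.
  have := @near_probability_lt R _ (borel_cV R k) P _ (flat_event theta) (v, 0)
    alpha%:E (measurable_flat_event theta) (@near_notin_flat_event theta (v, 0)).
  apply; apply: le_lt_trans Pa; apply: ereal_sup_ubound; exists v => //.
  congr (P _); apply/seteqP; split => x; rewrite /flat_event /= mul0r.
    by move=> ->; rewrite expr0n.
  by move=> H; apply/eqP; rewrite -sqrf_eq0 eq_le H sqr_ge0.
- move=> e /= e0 H; exists (e / 2); first exact: divr_gt0.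
  apply: H; rewrite /ball_ /= sub0r normrN gtr0_norm ?divr_gt0//.
  by rewrite ltr_pdivrMr// ltr_pMr// ltr1n.
Qed.

End depth_events.

(** * The depth region as a continuous image of a compact set *)

Section depth_region.
Context {R : realType} {k : nat}.
Implicit Types (theta x v : 'cV[R]_k) (A J S V : 'M[R]_k).

Lemma alpha_le_depthP (hk : (0 < k)%N) theta V (P : probability (borel_cV R k) R)
    (alpha : R) :
  (alpha%:E <= depth theta V P)%E <->
  forall A, A != 0 -> (alpha%:E <= P (quad_event theta A (isqrtmx V)))%E.
Proof.
split=> [aD A A0|H].
  apply: le_trans aD _; apply: ereal_inf_lbound.
  have vA : vec A != 0 by rewrite vec_eq0.
  exists ((enorm (vec A))^-1 *: vec A); first exact: sphere_normalize.
  rewrite -depth_eventE//; congr (P _); apply/seteqP.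
  have a0 : 0 < (enorm (vec A))^-1.
    by rewrite invr_gt0 lt_def enorm_eq0 vA sqrtr_ge0.
  by split => x; rewrite /= dotvZl pmulr_rge0.
apply: le_ereal_inf_tmp => _ [u u1 <-].
pose A : 'M[R]_k := (vec_mx u^T)^T.
have uA : u = vec A by rewrite /vec /A trmxK vec_mxK trmxK.
rewrite uA depth_eventE//; apply: H; rewrite -vec_eq0 -uA.
by apply/eqP => u0; move/sphereP: u1; rewrite u0 dotv0 => /eqP;
  rewrite eq_sym oner_eq0.
Qed.

Lemma posdef_psd_unitmx S : S^T = S -> (forall v, 0 <= dotv v (S *m v)) ->
  S \in unitmx -> posdef S.
Proof.
move=> ST psd uS; apply/posdef_quad; split => // v v0.
rewrite lt_def psd andbT; apply: contra v0 => /eqP/psd_kernel Sv.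
by rewrite -(mulKmx uS v) Sv// mulmx0.
Qed.

Lemma posdef_sqr S : posdef S -> posdef (S *m S).
Proof.
move=> pS; have ST := proj1 pS; apply/posdef_quad.
split => [|v v0]; first by rewrite trmx_mul ST.
rewrite -mulmxA -{1}ST -dotv_mulmxl dotv_gt0.
apply: contra v0 => /eqP Sv.
by rewrite -(mulKmx (posdef_unitmx pS) v) Sv mulmx0.
Qed.

(** A matrix of positive depth has a square root: otherwise [isqrtmx V = 0],
    so [W] is a negative multiple of [vec 1] and the depth is zero. *)
Lemma depth_gt0_sqrtmx (hk : (0 < k)%N) theta V
    (P : probability (borel_cV R k) R) (alpha : R) :
  0 < alpha -> (alpha%:E <= depth theta V P)%E ->
  posdef (sqrtmx V) /\ sqrtmx V *m sqrtmx V = V.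
Proof.
move=> a0 /(alpha_le_depthP hk) aD; rewrite /sqrtmx; case: xgetP => [S _ //|nS].
have kR : 0 < k%:R :> R by rewrite ltr0n.
have J0 : isqrtmx V = 0.
  rewrite /isqrtmx /sqrtmx; case: xgetP => [S _ /nS//|_].
  by rewrite /invmx -row_free_unit /row_free mxrank0 ltn_eqF.
have [I0|/aD] := eqVneq (1%:M : 'M[R]_k) 0.
  have := mxtrace1 R k; rewrite I0 mxtrace0 => /eqP.
  by rewrite lt_eqF.
rewrite J0 (_ : quad_event theta (1%:M : 'M[R]_k) 0 = set0).
  by rewrite measure0 lee_fin leNgt a0.
apply/seteqP; split => // x [_]; rewrite mul0mx mxtrace1 => /(_ erefl).
by rewrite leNgt kR.
Qed.

(** The direction [A = V] in the infimum defining the depth bounds [V] from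
    below: on the corresponding event [|V^{-1/2} z| <= |z|] for
    [z = x - theta], hence [(v . z)^2 <= (v^T V v) |z|^2] by Cauchy-Schwarz,
    and such an event is too small when [v^T V v <= e]. *)
Lemma depth_region_coercive (hk : (0 < k)%N) theta S
    (P : probability (borel_cV R k) R) (alpha e : R) :
  (forall v, sphere R k v -> (P (flat_event theta (v, e)) < alpha%:E)%E) ->
  posdef S -> \tr (S *m S) = k%:R ->
  (alpha%:E <= depth theta (S *m S) P)%E ->
  forall v, e * dotv v v <= dotv (S *m v) (S *m v).
Proof.
move=> Pe pS trS /(alpha_le_depthP hk) aD.
have kR : 0 < k%:R :> R by rewrite ltr0n.
have ST := proj1 pS; have uS := posdef_unitmx pS.
have V0 : S *m S != 0.
  by apply/eqP => V0; move: kR; rewrite -trS V0 mxtrace0 ltxx.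
have {aD} := aD _ V0; rewrite /isqrtmx sqrtmx_eq// => aD.
have unit_case v : sphere R k v -> e < dotv (S *m v) (S *m v).
  move=> v1; rewrite ltNge; apply/negP => Sve.
  have := Pe _ v1; rewrite ltNge => /negP; apply; apply: le_trans aD _.
  apply: le_measure; rewrite ?inE.
  - exact: measurable_quad_event.
  - exact: measurable_flat_event.
  move=> x [+ _]; rewrite /flat_event /=; set z := x - theta.
  set y := invmx S *m z; have zE : z = S *m y by rewrite mulKVmx.
  rewrite trS mulVf ?gt_eqF// mul1r -mulmxA.
  rewrite -{1}ST -dotv_mulmxl -zE => yz.
  rewrite [in leLHS]zE -[in leLHS]ST -dotv_mulmxl.
  apply: le_trans (dotv_cauchy_schwarz _ _) _.
  by apply: ler_pM => //; exact: dotv_ge0.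
move=> v; have [->|v0] := eqVneq v 0.
  by rewrite !dotv0 !mulr0 mulmx0 dotv0.
have n0 : 0 < dotv v v by rewrite dotv_gt0.
have := ltW (unit_case _ (sphere_normalize v0)).
rewrite -scalemxAr dotvZl dotvZr mulrA -expr2 exprVn sqr_enorm.
by rewrite ler_pdivlMl// mulrC.
Qed.

(** Pairs [(V^{1/2}, V^{-1/2})] of shape matrices with [v^T V v >= e |v|^2].
    Carrying the inverse along makes all the conditions closed, without any
    appeal to the continuity of the inverse or of the square root. *)
Definition root_pairs (e : R) : set ('M[R]_k * 'M[R]_k) :=
  [set p | p.1^T = p.1 /\ (forall v, 0 <= dotv v (p.1 *m v)) /\
    \tr (p.1 *m p.1) = k%:R /\ p.1 *m p.2 = 1%:M /\
    forall v, e * dotv v v <= dotv (p.1 *m v) (p.1 *m v)].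

Lemma root_pairs_posdef e p : root_pairs e p -> posdef p.1.
Proof.
move=> [pT [psd [_ [/mulmx1_unit[u1 _] _]]]].
exact: posdef_psd_unitmx.
Qed.

Lemma root_pairs_inv e p : root_pairs e p -> p.2 = invmx p.1.
Proof.
move=> Kp; have u1 := posdef_unitmx (root_pairs_posdef Kp).
by case: Kp => _ [_ [_ [p12 _]]]; rewrite -[p.2](mulKmx u1) p12 mulmx1.
Qed.

Lemma root_pairs_isqrtmx e p : root_pairs e p -> isqrtmx (p.1 *m p.1) = p.2.
Proof.
move=> Kp; rewrite /isqrtmx sqrtmx_eq ?(root_pairs_inv Kp)//.
exact: root_pairs_posdef Kp.
Qed.

Lemma root_pairs_shape e p : root_pairs e p -> is_shape (p.1 *m p.1).
Proof.
move=> Kp; apply/asboolP; split; first exact/posdef_sqr/(root_pairs_posdef Kp).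
by case: Kp => _ [_ []].
Qed.

Lemma closed_root_pairs e : closed (root_pairs e).
Proof.
have c1 (p : 'M[R]_k * 'M[R]_k) :
    (fun q : 'M[R]_k * 'M[R]_k => q.1) @ nbhs p --> p.1 by exact: cvg_fst.
have c2 (p : 'M[R]_k * 'M[R]_k) :
    (fun q : 'M[R]_k * 'M[R]_k => q.2) @ nbhs p --> p.2 by exact: cvg_snd.
have cv v : continuous (fun q : 'M[R]_k * 'M[R]_k => q.1 *m v).
  by move=> p; apply: (@cvg_mulmx _ _ (nbhs p)); [exact: c1|exact: cvg_cst].
have ct : continuous (fun q : 'M[R]_k * 'M[R]_k => \tr (q.1 *m q.1)).
  by move=> p; apply: (@cvg_mxtrace _ _ (nbhs p));
    apply: (@cvg_mulmx _ _ (nbhs p)); exact: c1.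
apply: closedI.
  apply: closed_mx_eq => p; last exact: c1.
  by apply: (@cvg_trmx _ _ (nbhs p)); exact: c1.
apply: closedI.
  apply: closed_forall => v; apply: closed_fun_le; first exact: cst_continuous.
  by move=> p; apply: (@cvg_dotv _ _ (nbhs p)); [exact: cvg_cst|exact: cv].
apply: closedI; first by apply: closed_comp (@closed_eq R k%:R) => p _; exact: ct.
apply: closedI.
  apply: closed_mx_eq => p; last exact: cst_continuous.
  by apply: (@cvg_mulmx _ _ (nbhs p)); [exact: c1|exact: c2].
apply: closed_forall => v; apply: closed_fun_le; first exact: cst_continuous.
by move=> p; apply: (@cvg_dotv _ _ (nbhs p)); exact: cv.
Qed.

Lemma root_pairs_box e : 0 < e -> root_pairs e `<=`
  [set A : 'M[R]_k | forall i j, `|A i j| <= 1 + k%:R] `*`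
  [set A : 'M[R]_k | forall i j, `|A i j| <= 1 + e^-1].
Proof.
move=> e0 p Kp; have [pT [_ [trp [p12 pe]]]] := Kp.
have sq (x c : R) : x ^+ 2 <= c -> `|x| <= 1 + c.
  by move=> xc; rewrite -real_normK ?num_real// in xc; have := normr_ge0 x; nra.
split => i j; apply: sq; have cE A : A i j = col j A i 0 by rewrite mxE.
  rewrite cE -trp -{2}pT trace_mul_tr (bigD1 j)//=.
  apply: le_trans (sqr_coord_le_dotv _ _) _.
  by rewrite lerDl sumr_ge0// => h _; exact: dotv_ge0.
rewrite cE; apply: le_trans (sqr_coord_le_dotv _ _) _.
rewrite -[leRHS]mulr1 ler_pdivlMl//; apply: le_trans (pe _) _.
rewrite colE mulmxA p12 mul1mx dotvE (bigD1 j)//= big1 ?addr0 => [|h hj].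
  by rewrite !mxE !eqxx mulr1.
by rewrite !mxE (negbTE hj) mul0r.
Qed.

(** The pairs that correspond to shape matrices of depth at least [alpha]. *)
Definition deep_pairs theta (P : probability (borel_cV R k) R) (alpha e : R) :
    set ('M[R]_k * 'M[R]_k) :=
  [set p | root_pairs e p /\
    forall A, A != 0 -> (alpha%:E <= P (quad_event theta A p.2))%E].

Lemma compact_deep_pairs theta (P : probability (borel_cV R k) R) (alpha e : R) :
  0 < e -> compact (deep_pairs theta P alpha e).
Proof.
move=> e0; apply: (subclosed_compact _
    (compact_setX (@compact_mx_box R k k (1 + k%:R))
                  (@compact_mx_box R k k (1 + e^-1)))); last first.
  by move=> p [/(root_pairs_box e0)].
move=> p clp; have Kp : root_pairs e p.
  apply: closed_root_pairs; apply: closure_subset clp; first by move=> ? [].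
split => // A A0; rewrite leNgt; apply/negP => Pp.
have u2 : p.2 \in unitmx by have [_ [_ [_ [/mulmx1_unit[]]]]] := Kp.
have nP : \forall J \near p.2, (P (quad_event theta A J) < alpha%:E)%E.
  apply: (@near_probability_lt R _ (borel_cV R k) P _ (quad_event theta A)) => //.
    by move=> J; exact: measurable_quad_event.
  by move=> x; exact: near_notin_quad_event.
have [q [[Kq /(_ _ A0)]]] := clp _ (@cvg_snd _ _ _ _ _ _ nP).
by rewrite /= leNgt => /negP.
Qed.

Lemma is_shape1 : is_shape (1%:M : 'M[R]_k).
Proof.
apply/asboolP; split; last exact: mxtrace1.
apply/posdef_quad; split; first exact: trmx1.
by move=> v; rewrite mul1mx dotv_gt0.
Qed.

(** The shape matrix [S S] of a pair [(S, S^{-1})]; the identity outside the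
    pairs of interest. *)
Definition pair_shape (p : 'M[R]_k * 'M[R]_k) : shape_matrix R k :=
  insubd (Shape is_shape1) (p.1 *m p.1).

Lemma pair_shapeE e p : root_pairs e p -> pair_shape p = p.1 *m p.1 :> 'M[R]_k.
Proof. by move=> /root_pairs_shape Vs; rewrite /pair_shape (insubdK _ Vs). Qed.

Lemma depth_regionE (hk : (0 < k)%N) theta (P : probability (borel_cV R k) R)
    (alpha e : R) : 0 < alpha ->
  (forall v, sphere R k v -> (P (flat_event theta (v, e)) < alpha%:E)%E) ->
  depth_region theta alpha P = pair_shape @` deep_pairs theta P alpha e.
Proof.
move=> a0 Pe; apply/seteqP; split => [V aV|_ [p [Kp pA] <-]]; last first.
  rewrite /depth_region /= (pair_shapeE Kp); apply/alpha_le_depthP => //.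
  by rewrite (root_pairs_isqrtmx Kp).
have [pS SS] := depth_gt0_sqrtmx hk a0 aV.
set S := sqrtmx V in pS SS.
have trS : \tr (S *m S) = k%:R by rewrite SS; case: (V) => W /= /asboolP[].
have Kp : root_pairs e (S, invmx S).
  split; first exact: (proj1 pS); split; first by move=> v; exact: posdef_ge0.
  split=> //; split; first by rewrite mulmxV// posdef_unitmx.
  by apply: (depth_region_coercive hk Pe pS trS); rewrite SS.
exists (S, invmx S); last by apply: val_inj; rewrite /= (pair_shapeE Kp).
by split => //; apply/alpha_le_depthP.
Qed.

(** At a pair [p], the matrix [V^{-1/2} V_q V^{-1/2}] tends to the identity as
    [q] tends to [p], so its logarithm tends to zero. *)
Lemma near_geodist (hk : (0 < k)%N) e p r : root_pairs e p -> 0 < r ->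
  \forall q \near p, root_pairs e q ->
    geodist (pair_shape p) (pair_shape q) < r.
Proof.
move=> Kp r0; have kR : 0 < k%:R :> R by rewrite ltr0n.
set sk := Num.sqrt k%:R : R; have sk0 : 0 <= sk by exact: sqrtr_ge0.
(* eigenvalues within a factor [expR c] of 1 give a distance at most
   [sqrt k * c < r] *)
pose c := r / (sk + 1); have c0 : 0 < c by rewrite divr_gt0// ltr_wpDl.
have skc : sk * c < r.
  rewrite /c mulrCA -[ltRHS]mulr1 ltr_pM2l// ltr_pdivrMr ?ltr_wpDl//.
  by rewrite mul1r ltrDl.
pose eta := Num.min (1 - expR (- c)) (expR c - 1).
have eta0 : 0 < eta.
  by rewrite lt_min !subr_gt0 -{1}expR0 ltr_expR oppr_lt0 c0 -expR0 ltr_expR.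
pose M (q : 'M[R]_k * 'M[R]_k) := p.2 *m (q.1 *m q.1) *m p.2.
have p12 : p.1 *m p.2 = 1%:M by case: Kp => _ [_ [_ []]].
have Mp : M p = 1%:M.
  by rewrite /M !mulmxA (mulmx1C p12) mul1mx.
have cM : M @ nbhs p --> (1%:M : 'M[R]_k).
  rewrite -Mp; apply: (@cvg_mulmx _ _ (nbhs p)); last exact: cvg_cst.
  apply: (@cvg_mulmx _ _ (nbhs p)); first exact: cvg_cst.
  by apply: (@cvg_mulmx _ _ (nbhs p)); exact: cvg_fst.
have nM : \forall q \near p, forall i j, `|(M q - 1%:M) i j| <= eta / k%:R.
  apply: (@filter_forall _ _ _ (nbhs p)) => i.
  apply: (@filter_forall _ _ _ (nbhs p)) => j.
  have cMij : (fun q => M q i j) @ nbhs p --> (1%:M : 'M[R]_k) i j.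
    exact: cvg_coord.
  have := cvgr_distC_le _ _ cMij _ (divr_gt0 eta0 kR) => /(_ _).
  by apply: (@filterS _ (nbhs p)) => q; rewrite !mxE.
apply: (@filterS _ (nbhs p) _ _ _ _ nM) => {}q {}nM Kq; apply: le_lt_trans skc.
rewrite /geodist (pair_shapeE Kp) (pair_shapeE Kq) (root_pairs_isqrtmx Kp).
apply: frobenius_logmx_le; first exact: ltW.
move=> v; have := quad_form_le v nM.
rewrite mulrC mulrA -mulrA [k%:R * _]mulrC divfK ?gt_eqF//.
rewrite mulmxBl mul1mx dotvBr -/(M q) ler_norml.
have : eta <= 1 - expR (- c) by rewrite ge_min lexx.
have : eta <= expR c - 1 by rewrite ge_min lexx orbT.
move=> eb ea /andP[lo hi]; have n0 := dotv_ge0 v.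
have := ler_wpM2r n0 ea; have := ler_wpM2r n0 eb.
by rewrite !mulrBl !mul1r => ? ?; apply/andP; split; lra.
Qed.

Lemma continuous_pair_shape (hk : (0 < k)%N) e (G : set ('M[R]_k * 'M[R]_k)) :
  G `<=` root_pairs e -> {within G, continuous pair_shape}.
Proof.
move=> GK; apply/subspace_continuousP => p Gp B.
rewrite nbhsE => -[U [oU Up] UB].
have [r r0 rU] : exists2 r, 0 < r & geoball (pair_shape p) r `<=` U.
  exact: oU Up.
have := near_geodist hk (GK _ Gp) r0.
rewrite /nbhs /= /within /=; apply: filterS => q qr Gq.
by apply: UB; apply: rU; apply: qr; exact: GK.
Qed.

Lemma geo_bounded_pair_shape (hk : (0 < k)%N) e : 0 < e ->
  geo_bounded (pair_shape @` root_pairs e).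
Proof.
move=> e0; have kR : 0 < k%:R :> R by rewrite ltr0n.
have ei0 : 0 < e^-1 by rewrite invr_gt0.
(* [1 + c <= expR c] makes [expR c] exceed both eigenvalue bounds, [k] for [V]
   and [e^-1] for its inverse *)
pose c := k%:R + e^-1; have c0 : 0 < c by rewrite addr_gt0.
have cE : 1 + c <= expR c := expR_ge1Dx c.
exists (Num.sqrt k%:R * c + 1).
  by rewrite ltr_wpDl// mulr_ge0 ?sqrtr_ge0// ltW.
move=> _ [p Kp <-] /=; rewrite ltr_pwDr//.
rewrite /geodist (pair_shapeE Kp) (root_pairs_isqrtmx Kp) mulmx1.
have [pT [_ [trp [p12 pe]]]] := Kp.
have JT : p.2^T = p.2 by rewrite (root_pairs_inv Kp) trmx_inv pT.
apply: frobenius_logmx_le; first exact: ltW.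
move=> v; set w := p.2 *m v.
have -> : dotv v (p.2 *m p.2 *m v) = dotv w w.
  by rewrite dotv_mulmxl JT mulmxA.
have vE : v = p.1 *m w by rewrite mulmxA p12 mul1mx.
have h1 : dotv v v <= k%:R * dotv w w.
  by rewrite vE -trp -{4}pT; exact: dotv_mulmx_le_trace.
have h2 : dotv w w <= e^-1 * dotv v v by rewrite ler_pdivlMl// vE; exact: pe.
rewrite expRN ler_pdivrMl ?expR_gt0//; apply/andP; split.
  apply: le_trans h1 _; apply: ler_wpM2r; first exact: dotv_ge0.
  by rewrite (le_trans _ cE)// /c; lra.
apply: le_trans h2 _; apply: ler_wpM2r; first exact: dotv_ge0.
by rewrite (le_trans _ cE)// /c; lra.
Qed.

Lemma alpha_gt0 (hk : (0 < k)%N) theta (P : probability (borel_cV R k) R)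
    (alpha : R) : (max_hyperplane_mass theta P < alpha%:E)%E -> 0 < alpha.
Proof.
move=> Pa; rewrite -lte_fin; apply: le_lt_trans Pa.
pose u : 'cV[R]_k := const_mx 1.
have u0 : u != 0.
  apply/eqP => /matrixP/(_ (Ordinal hk) 0); rewrite !mxE => /eqP.
  by rewrite oner_eq0.
apply: le_trans (measure_ge0 P [set x | dotv ((enorm u)^-1 *: u) (x - theta) = 0]) _.
by apply: ereal_sup_ubound; exists ((enorm u)^-1 *: u) => //; exact: sphere_normalize.
Qed.

End depth_region.

Theorem theorem3p2 (R : realType) (k : nat) (hk : (0 < k)%N)
    (P : probability (borel_cV R k) R) (theta : 'cV[R]_k) (alpha : R)
    (halpha : (max_hyperplane_mass theta P < alpha%:E)%E) :
  geo_bounded (depth_region theta alpha P) /\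
  compact (depth_region theta alpha P).
Proof.
have [e e0 Pe] := flat_event_lt halpha.
rewrite (depth_regionE hk (alpha_gt0 hk halpha) Pe); split.
  have [r r0 rP] := @geo_bounded_pair_shape R k hk e e0.
  by exists r => //; apply: subset_trans rP; apply: image_subset => p [].
apply: continuous_compact; last exact: compact_deep_pairs.
by apply: (@continuous_pair_shape _ _ hk e) => p [].
Qed.
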